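(* Let $Q$ be a toric quiver diagram with $G$ nodes and $E$ arrows, and let $x = E-G$. Then every toric superpotential $W$ for $Q$ can be constructed from two decompositions of $Q$ into disjoint loops whose total number of loops is $x$: there exist an integer $n$ with $0\le n\le x$ and two decompositions $D_+$ and $D_-$ of $Q$ into disjoint loops, $D_+$ consisting of $n$ loops and $D_-$ consisting of $x-n$ loops, such that $$W=\sum_{\ell\in D_+} X_\ell-\sum_{\ell\in D_-}X_\ell ,$$ where $X_\ell$ denotes the product of all the arrows in the loop $\ell$.
   Context: A quiver diagram is a finite directed multigraph (multiple arrows and arrows from a node to itself are allowed). A toric quiver diagram is a connected finite quiver diagram in which every node has equal indegree and outdegree (a loop at a node counts once in each). To each arrow of $Q$ is associated a variable (''field''), and these variables commute (Abelian case of a single brane, where all fields are complex-valued). A loop in $Q$ is a closed directed walk of positive length; nodes may be visited more than once. A decomposition of $Q$ into disjoint loops is a finite collection of loops such that every arrow of $Q$ is traversed exactly once in total by the loops in the collection; in particular the loops are pairwise arrow-disjoint and together cover all arrows. A toric superpotential for $Q$ is a formal polynomial $W$ in the arrow variables, all of whose terms are distinct monomials with coefficient $+1$ or $-1$, such that: (i) (toric condition) each arrow variable appears exactly twice in $W$, and with opposite sign, i.e. it appears exactly once (counted with multiplicity) among the terms with coefficient $+1$ and exactly once among the terms with coefficient $-1$; (ii) (tiling condition) $W$ has exactly $x=E-G$ terms; (iii) (gauge invariance) each term is, up to sign, the product of the arrows traversed by some loop in $Q$; (iv) each term contains at least three fields. *)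

(* Defs.v *)
(* MathComp, with multinomials for the polynomial ring. *)
From HB Require Import structures.
From mathcomp Require Import all_boot all_order all_algebra.
From mathcomp Require Export mpoly.

Set Implicit Arguments.
Unset Strict Implicit.
Unset Printing Implicit Defensive.

Import Order.TTheory GRing.Theory Num.Theory.
Local Open Scope ring_scope.

Record quiver := Quiver {
  node : finType;
  arrow : finType;
  src : arrow -> node;
  tgt : arrow -> node
}.

Definition adjacent (Q : quiver) : rel (node Q) := fun u v =>
  [exists a : arrow Q, ((src a == u) && (tgt a == v))
                    || ((src a == v) && (tgt a == u))].

(* Exactly one connected component, so the quiver has at least one node. *)
Definition quiver_connected (Q : quiver) : bool :=
  n_comp (@adjacent Q) predT == 1%N.

Definition outdegree (Q : quiver) (v : node Q) : nat :=
  #|[set a : arrow Q | src a == v]|.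

Definition indegree (Q : quiver) (v : node Q) : nat :=
  #|[set a : arrow Q | tgt a == v]|.

Record toric_quiver (Q : quiver) : Prop := ToricQuiver {
  toric_connected : quiver_connected Q;
  toric_balanced : forall v : node Q, indegree v = outdegree v
}.

(* x = E - G, as an integer: it is -1 for a single node without arrows. *)
Definition num_terms (Q : quiver) : int := #|arrow Q|%:Z - #|node Q|%:Z.

(* A loop is given by the sequence of its arrows from some base point;
   [cycle] also requires the last arrow to end where the first one starts. *)
Definition is_loop (Q : quiver) (l : seq (arrow Q)) : bool :=
  (l != [::]) && cycle (fun a b => tgt a == src b) l.

Definition loop_decomposition (Q : quiver) (D : seq (seq (arrow Q))) : Prop :=
  (forall l, l \in D -> is_loop l) /\
  (forall a : arrow Q, count_mem a (flatten D) = 1%N).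

(* Commutative polynomials with one variable per arrow: mpoly indexes its
   variables by ordinals, so [enum_rank] numbers the arrows. *)
Definition fieldpoly (Q : quiver) := {mpoly int[#|arrow Q|]}.

Definition field (Q : quiver) (a : arrow Q) : fieldpoly Q := 'X_(enum_rank a).

Definition loop_product (Q : quiver) (l : seq (arrow Q)) : fieldpoly Q :=
  \prod_(a <- l) field a.

(* The terms of W are the W@_m *: 'X_[m] for m in msupp W, which is
   duplicate-free; m (enum_rank a) is the multiplicity of arrow a in m. *)
Record toric_superpotential (Q : quiver) (W : fieldpoly Q) : Prop :=
  ToricSuperpotential {
  superpotential_coeff :
    forall m, m \in msupp W -> W@_m = 1 \/ W@_m = -1;
  superpotential_toric_pos : forall a : arrow Q,
    (\sum_(m <- msupp W | (W@_m == 1)%R) m (enum_rank a) = 1)%N;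
  superpotential_toric_neg : forall a : arrow Q,
    (\sum_(m <- msupp W | (W@_m == -1)%R) m (enum_rank a) = 1)%N;
  superpotential_tiling : (size (msupp W))%:Z = num_terms Q;
  superpotential_gauge : forall m, m \in msupp W ->
    exists l : seq (arrow Q), is_loop l /\ 'X_[m] = loop_product l;
  superpotential_degree : forall m, m \in msupp W -> (3 <= mdeg m)%N
}.

(* Main.v *)
Require Import Defs.
From HB Require Import structures.
From mathcomp Require Import all_boot all_order all_algebra.

Set Implicit Arguments.
Unset Strict Implicit.
Unset Printing Implicit Defensive.

Import Order.TTheory GRing.Theory Num.Theory.
Local Open Scope ring_scope.

(** Split the terms of [W] by sign and use gauge invariance to choose one loop per term. A monomial
    determines the multiplicity of each arrow in its loop ([loop_product_count]), so the toric
    condition says that the loops chosen for one sign traverse every arrow exactly once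
    ([loop_decomposition_map]). The tiling condition then counts the loops, [n] being the number of
    positive terms. *)

(** Choice over a finite list, by induction and hence without an axiom; [u0] is the value off the
    list. *)
Lemma seq_exists_fun (T : eqType) (U : Type) (u0 : U) (P : T -> U -> Prop)
    (s : seq T) :
  (forall x, x \in s -> exists u, P x u) ->
  exists f : T -> U, forall x, x \in s -> P x (f x).
Proof.
elim: s => [|x s IHs] exP; first by exists (fun=> u0).
have [u Pu] := exP x (mem_head x s).
have [|f Pf] := IHs; first by move=> y sy; apply: exP; rewrite inE sy orbT.
exists (fun y => if y == x then u else f y) => y; rewrite inE.
by case: eqVneq => [->|_] //= /Pf.
Qed.

Lemma loop_productE (Q : quiver) (l : seq (arrow Q)) :
  loop_product l = 'X_[(\sum_(a <- l) U_(enum_rank a))%MM].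
Proof. by rewrite /loop_product mprodXE. Qed.

Lemma loop_product_count (Q : quiver) (m : 'X_{1..#|arrow Q|})
    (l : seq (arrow Q)) (a : arrow Q) :
  'X_[m] = loop_product l -> count_mem a l = m (enum_rank a).
Proof.
move=> /(congr1 (mcoeff m)); rewrite loop_productE !mcoeffX eqxx.
(* The coefficient at [m] is 1 on the left, so it cannot vanish on the right: the exponent vectors
   agree. *)
case: eqP => // <- _; rewrite mnm_sumE -sum1_count big_mkcond /=.
by apply: eq_bigr => b _; rewrite mnm1E (inj_eq enum_rank_inj); case: eqP.
Qed.

Lemma loop_decomposition_map (Q : quiver) (s : seq 'X_{1..#|arrow Q|})
    (f : 'X_{1..#|arrow Q|} -> seq (arrow Q)) :
  (forall m, m \in s -> is_loop (f m) /\ 'X_[m] = loop_product (f m)) ->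
  (forall a : arrow Q, (\sum_(m <- s) m (enum_rank a) = 1)%N) ->
  loop_decomposition (map f s).
Proof.
move=> fP sum1; split=> [_ /mapP[m sm ->]|a]; first by case: (fP m sm).
rewrite count_flatten -map_comp sumnE big_map -[RHS](sum1 a).
by apply: eq_big_seq => m /fP[_ Xm]; apply: loop_product_count.
Qed.

Theorem proposition2 (Q : quiver) (hQ : toric_quiver Q)
    (W : fieldpoly Q) (hW : toric_superpotential W) :
  exists n : int, 0 <= n <= num_terms Q /\
  exists Dp Dm : seq (seq (arrow Q)),
    [/\ loop_decomposition Dp,
        loop_decomposition Dm,
        (size Dp)%:Z = n,
        (size Dm)%:Z = num_terms Q - n
      & W = \sum_(l <- Dp) loop_product l - \sum_(l <- Dm) loop_product l].
Proof.
case: hW => coeffW posW negW sizeW gaugeW _.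
have [f fP] := seq_exists_fun [::] gaugeW.
pose s c := [seq m <- msupp W | W@_m == c].
have sP c m : m \in s c -> is_loop (f m) /\ 'X_[m] = loop_product (f m).
  by rewrite mem_filter => /andP[_ /fP].
(* As coefficients on the support are 1 or -1, the negative terms are the complement of the positive
   ones. *)
have negE : s (-1) = [seq m <- msupp W | W@_m != 1].
  by apply: eq_in_filter => m /coeffW[] ->.
have sizeE : (size (s 1))%:Z + (size (s (-1)))%:Z = num_terms Q.
  by rewrite -sizeW -PoszD negE !size_filter count_predC.
exists (size (s 1))%:Z; split; first by rewrite -sizeE lerDl.
exists (map f (s 1)), (map f (s (-1))); split; rewrite ?size_map //.
- by apply: loop_decomposition_map (@sP 1) _ => a; rewrite big_filter.
- by apply: loop_decomposition_map (@sP (-1)) _ => a; rewrite big_filter.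
- by rewrite -sizeE addrC addKr.
have sumE c : \sum_(l <- map f (s c)) loop_product l = \sum_(m <- s c) 'X_[m].
  by rewrite big_map; apply: eq_big_seq => m /sP[].
rewrite !sumE -sumrN negE !big_filter [LHS]mpolyE.
rewrite (bigID (fun m => W@_m == 1)) /=; congr (_ + _).
  by apply: eq_bigr => m /eqP ->; rewrite scale1r.
(* Membership in the support must be kept: only there does a coefficient other than 1 have to be
   -1. *)
rewrite big_seq_cond [RHS]big_seq_cond.
by apply: eq_bigr => m /andP[/coeffW[] -> //]; rewrite scaleN1r.
Qed.
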